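(* There exist a domain $X$ with $|X|=7$, a hypothesis class $\mathcal{H}$ of functions $X\to\{0,1\}$ with $\mathrm{VC}(\mathcal{H})=1$, a perturbation type $\mathcal{U}:X\to 2^X$, and two distributions $P^1$ and $P^2$ over $X\times\{0,1\}$ that are indistinguishable with error and margin oracles for $\mathcal{H}$, that is, $P^1(\mathrm{err}_h)=P^2(\mathrm{err}_h)$ and $P^1(\mathrm{mar}^{\mathcal{U}}_h)=P^2(\mathrm{mar}^{\mathcal{U}}_h)$ for every $h\in\mathcal{H}$, while the minimizers in $\mathcal{H}$ of the robust losses $\mathcal{L}^{\mathcal{U}}_{P^1}$ and $\mathcal{L}^{\mathcal{U}}_{P^2}$ differ.
   Context: A perturbation type is a map $\mathcal{U}:X\to 2^X$ with $x\in\mathcal{U}(x)$ for all $x$. For $h:X\to\{0,1\}$, the error region is $\mathrm{err}_h=\{(x,y)\in X\times\{0,1\}: h(x)\neq y\}$ and the margin area is $\mathrm{mar}^{\mathcal{U}}_h=\{(x,y)\in X\times\{0,1\}:\exists z\in\mathcal{U}(x),\ h(x)\neq h(z)\}$. The robust loss of $h$ under $P$ is $\mathcal{L}^{\mathcal{U}}_P(h)=\Pr_{(x,y)\sim P}[\exists z\in\mathcal{U}(x): h(z)\neq y]=P(\mathrm{err}_h\cup\mathrm{mar}^{\mathcal{U}}_h)$. An error oracle for $\mathcal{H}$ returns $P(\mathrm{err}_h)$ for any queried $h\in\mathcal{H}$, and a margin oracle for $\mathcal{H}$ returns $P(\mathrm{mar}^{\mathcal{U}}_h)$ for any queried $h\in\mathcal{H}$.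 *)

(* Defs.v *)
From HB Require Import structures.
From mathcomp Require Import all_boot all_order all_algebra.
From mathcomp Require Import all_classical all_reals all_analysis.

Set Implicit Arguments.
Unset Strict Implicit.
Unset Printing Implicit Defensive.

Import Order.TTheory GRing.Theory Num.Theory.

Local Open Scope classical_set_scope.
Local Open Scope card_scope.
Local Open Scope ereal_scope.

Section VC.
Variable X : Type.

Definition shatters (H : set (X -> bool)) (A : set X) : Prop :=
  forall B, B `<=` A -> exists2 h, H h & A `&` [set x | h x] = B.

(* VC(H) = n, i.e. n is the maximal size of a finite set shattered by H
   (an infinite shattered set has shattered finite subsets of every size). *)
Definition VC_dim_eq (H : set (X -> bool)) (n : nat) : Prop :=
  (exists2 A : set X, A #= `I_n & shatters H A) /\
  (forall (A : set X) (m : nat), A #= `I_m -> shatters H A -> (m <= n)%N).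

End VC.

Section robust_loss.
Variables (d : measure_display) (X : measurableType d) (R : realType).

Definition perturbation_type (U : X -> set X) : Prop := forall x, U x x.

Definition err (h : X -> bool) : set (X * bool) := [set p | h p.1 <> p.2].

Definition mar (U : X -> set X) (h : X -> bool) : set (X * bool) :=
  [set p | exists2 z, U p.1 z & h p.1 <> h z].

Definition robust_loss (U : X -> set X) (P : probability (X * bool)%type R)
    (h : X -> bool) : \bar R :=
  P [set p | exists2 z, U p.1 z & h z <> p.2].

Lemma robust_lossE (U : X -> set X) (P : probability (X * bool)%type R)
    (h : X -> bool) : perturbation_type U ->
  robust_loss U P h = P (err h `|` mar U h).
Proof.
move=> Urefl; rewrite /robust_loss; congr (P _).
apply/seteqP; split => -[x y] /=.
- move=> [z Uz hz]; have [hx|hx] := eqVneq (h x) y; last by left; apply/eqP.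
  by right; exists z => //=; rewrite hx => /esym.
- move=> [/= hx|[/= z Uz hz]]; first by exists x.
  have [hx|hx] := eqVneq (h x) y; last by exists x => //; apply/eqP.
  by exists z => //; rewrite -hx => /esym.
Qed.

(* The answers of the error oracle and of the margin oracle coincide on every
   admissible query. *)
Definition oracle_indistinguishable (H : set (X -> bool)) (U : X -> set X)
    (P1 P2 : probability (X * bool)%type R) : Prop :=
  forall h, H h ->
    P1 (err h) = P2 (err h) /\ P1 (mar U h) = P2 (mar U h).

Definition robust_minimizers (H : set (X -> bool)) (U : X -> set X)
    (P : probability (X * bool)%type R) : set (X -> bool) :=
  [set h | H h /\ forall g, H g -> robust_loss U P h <= robust_loss U P g].

End robust_loss.

(* Main.v *)
Require Import Defs.
From HB Require Import structures.
From mathcomp Require Import all_boot all_order all_algebra.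
From mathcomp Require Import all_classical all_reals all_analysis.

(** Error and margin oracles reveal [P (err h)] and [P (mar h)] but not
    [P (err h `&` mar h)].  Two hypotheses [h1], [h2] and two uniform
    distributions on two positively labelled points each are chosen so that every
    error and margin region has mass 1/2: under the first distribution the two
    regions coincide for [h1] (robust loss 1/2) and are disjoint for [h2] (robust
    loss 1); under the second the roles are exchanged. *)

Local Open Scope classical_set_scope.
Local Open Scope card_scope.

Import Order.TTheory GRing.Theory Num.Theory.

(** A point where the hypotheses disagree is a shattered singleton; shattering two points would need
    more than two hypotheses. *)
Lemma VC_dim_eq_pair {X : Type} (h1 h2 : X -> bool) :
  h1 <> h2 -> VC_dim_eq [set h1; h2] 1.
Proof.
move=> h12; split.
  have [x hx] : exists x, h1 x <> h2 x.
    by apply/existsNP => h; apply: h12; apply/funext.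
  wlog [h1x h2x] : h1 h2 h12 hx / h1 x = true /\ h2 x = false.
    case h1x: (h1 x); case h2x: (h2 x); try by case: hx; rewrite h1x h2x.
      by move=> /(_ h1 h2); apply; rewrite ?h1x ?h2x.
    move=> /(_ h2 h1); rewrite setUC; apply; rewrite ?h1x ?h2x//.
    exact/nesym.
  exists [set x]; first exact: card_set1.
  move=> B /subset_set1[->|->].
    exists h2; first by right.
    by apply/seteqP; split => // y [->] /=; rewrite h2x.
  exists h1; first by left.
  by apply/seteqP; split => [y []//|y ->]; split.
move=> A m Am AH; rewrite leqNgt; apply/negP => m1.
have /card_set_bijP[f [_ _ fsurj]] := Am.
have [a Aa fa0] := fsurj 0%N (ltnW m1).
have [b Ab fb1] := fsurj 1%N m1.
have ab : a <> b by move=> ab; move: fb1; rewrite -ab fa0.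
(* the traces [set0], [{a}], [{b}] would need three hypotheses *)
have [g0 Hg0 g0E] := AH _ (@sub0set _ A).
have [g1 Hg1 g1E] : exists2 h, [set h1; h2] h & A `&` [set x | h x] = [set a].
  by apply: AH => _ ->.
have [g2 Hg2 g2E] : exists2 h, [set h1; h2] h & A `&` [set x | h x] = [set b].
  by apply: AH => _ ->.
have g01 : g0 <> g1.
  by move=> g01; have : [set a] a by []; rewrite -g1E -g01 g0E.
have g02 : g0 <> g2.
  by move=> g02; have : [set b] b by []; rewrite -g2E -g02 g0E.
have g12 : g1 <> g2.
  by move=> g12; apply: ab; have : [set a] a by []; rewrite -g1E g12 g2E.
(* Pigeonhole: three members of a pair cannot be pairwise distinct. *)
by case: Hg0 Hg1 Hg2 g01 g02 g12 => -> [] -> [] ->.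
Qed.

Section half_mixture.
Local Open Scope ring_scope.
Context d (T : measurableType d) (R : realType).
Variables p q : T.

Definition half_sum : set T -> \bar R :=
  measure_add (mscale (2^-1)%:nng \d_p) (mscale (2^-1)%:nng \d_q).

HB.instance Definition _ := Measure.on half_sum.

Let half_sumE A : half_sum A = (((p \in A)%:R + (q \in A)%:R) / 2)%:E.
Proof.
rewrite /half_sum measure_addE mulrDl EFinD.
by congr (_ + _)%E; rewrite mulrC EFinM -diracE.
Qed.

Let half_sum_setT : half_sum setT = 1%E.
Proof. by rewrite half_sumE !in_setT -natrD divff// pnatr_eq0. Qed.

HB.instance Definition _ :=
  Measure_isProbability.Build _ _ _ half_sum half_sum_setT.

Definition half_mixture : probability T R := half_sum.

(** Masses become boolean memberships, which evaluate at concrete points. *)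
Lemma half_mixtureE A :
  half_mixture A = (((p \in A)%:R + (q \in A)%:R) / 2)%:E.
Proof. exact: half_sumE. Qed.

End half_mixture.

Section binary_perturbation.
Context {X : Type}.
Variable w : X -> X.

Definition binary_perturbation (x : X) : set X := [set x; w x].

Lemma exists2_binary_perturbation x (Q : X -> Prop) :
  (exists2 z, binary_perturbation x z & Q z) <-> Q x \/ Q (w x).
Proof.
split => [[z [->|->]]|[]]; [by left|by right|exists x|exists (w x)] => //.
  by left.
by right.
Qed.

End binary_perturbation.

Section binary_perturbation_regions.
Context d (X : measurableType d).
Variables (w : X -> X) (h : X -> bool) (p : X * bool).

Lemma in_err : (p \in err h) = (h p.1 != p.2).
Proof. by apply/idP/idP; rewrite inE => /eqP. Qed.

Lemma in_mar : (p \in mar (binary_perturbation w) h) = (h p.1 != h (w p.1)).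
Proof.
apply/idP/idP; rewrite inE /mar /= exists2_binary_perturbation.
  (* The center itself contributes nothing, as [h] agrees with itself there. *)
  by case=> // /eqP.
by move=> /eqP; right.
Qed.

Lemma in_robust_loss_region :
  (p \in [set p : X * bool | exists2 z, binary_perturbation w p.1 z & h z <> p.2])
  = (h p.1 != p.2) || (h (w p.1) != p.2).
Proof.
apply/idP/orP; rewrite inE /= exists2_binary_perturbation.
  by case=> ?; [left|right]; exact/eqP.
by case=> /eqP ?; [left|right].
Qed.

End binary_perturbation_regions.

Lemma robust_minimizers_pair {d} {X : measurableType d} {R : realType}
    (U : X -> set X) (P : probability (X * bool)%type R) (h1 h2 : X -> bool) :
  (robust_loss U P h1 < robust_loss U P h2)%E ->
  robust_minimizers [set h1; h2] U P = [set h1].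
Proof.
move=> h12; apply/seteqP; split => h.
  move=> [[->//|->]] /(_ h1 (or_introl erefl)).
  by rewrite leNgt h12.
move=> ->; split; first by left.
by move=> g [->//|->]; exact: ltW.
Qed.

(** A separate name lets the ordinals carry the discrete sigma-algebra; the successor keeps them
    inhabited. *)
Definition discrete_ord n : Type := 'I_n.+1.

HB.instance Definition _ n := Choice.on (discrete_ord n).
HB.instance Definition _ n := isPointed.Build (discrete_ord n) ord0.
HB.instance Definition _ n := @isMeasurable.Build default_measure_display
  (discrete_ord n) discrete_measurable discrete_measurable0
  discrete_measurableC discrete_measurableU.

Lemma card_discrete_ord n : [set: discrete_ord n] #= `I_n.+1.
Proof.
apply/card_set_bijP; exists (@nat_of_ord n.+1); split.
- by move=> i _ /=; exact: ltn_ord.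
- by move=> i j _ _; exact: val_inj.
- by move=> k /= kn; exists (Ordinal kn).
Qed.

(* The points 4 and 5, where the two hypotheses disagree, carry no mass: 4 puts
   0 in the margin of [hyp1] and 1 in that of [hyp2]; 5 puts 3 in the margin of
   [hyp1] and 2 in that of [hyp2].  The point 6 is padding. *)
Definition witness (x : discrete_ord 6) : discrete_ord 6 :=
  if (x < 2)%N then @Ordinal 7 4 isT
  else if (x < 4)%N then @Ordinal 7 5 isT else x.

(** Both hypotheses reject 0 and 2 and accept 1 and 3, so with positive labels each pair 0, 1 and 2,
    3 contains exactly one error. *)
Definition hyp1 (x : discrete_ord 6) : bool := nat_of_ord x \in [:: 1; 3; 4]%N.

Definition hyp2 (x : discrete_ord 6) : bool := nat_of_ord x \in [:: 1; 3; 5]%N.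

Definition positive_example k (k7 : (k < 7)%N) : discrete_ord 6 * bool :=
  (Ordinal k7, true).

Theorem theorem9 (R : realType) :
  exists (d : measure_display) (X : measurableType d),
    [set: X] #= `I_7 /\
    (forall A : set X, measurable A) /\
    exists (H : set (X -> bool)) (U : X -> set X)
           (P1 P2 : probability (X * bool)%type R),
      VC_dim_eq H 1 /\
      perturbation_type U /\
      oracle_indistinguishable H U P1 P2 /\
      exists h1 h2 : X -> bool,
        robust_minimizers H U P1 = [set h1] /\
        robust_minimizers H U P2 = [set h2] /\
        h1 <> h2.
Proof.
have hyp12 : hyp1 <> hyp2 by move=> /(congr1 (@^~ (@Ordinal 7 4 isT))).
(* The losses 1/2 and 1, in the form to which both robust loss comparisons evaluate. *)
have half_lt1 : (((1 + 0) / 2)%R%:E < ((1 + 1) / 2)%R%:E :> \bar R)%E.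
  by rewrite lte_fin ltr_pM2r ?invr_gt0 ?ltr0n// ltrD2l ltr01.
exists default_measure_display, (discrete_ord 6).
split; first exact: card_discrete_ord.
split; first by [].
exists [set hyp1; hyp2], (binary_perturbation witness).
exists (half_mixture _ _ R (@positive_example 0 isT) (@positive_example 1 isT)).
exists (half_mixture _ _ R (@positive_example 2 isT) (@positive_example 3 isT)).
split; first exact: VC_dim_eq_pair.
split; first by move=> x; left.
split.
  (* The margin contains the first point of one pair but the second of the other, so the two sums
     differ by the order of their terms. *)
  by move=> h [] ->; split; rewrite !half_mixtureE ?in_err ?in_mar//= addrC.
exists hyp1, hyp2; split; last split => //.
  apply: robust_minimizers_pair.
  by rewrite /robust_loss !half_mixtureE !in_robust_loss_region.
rewrite setUC; apply: robust_minimizers_pair.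
by rewrite /robust_loss !half_mixtureE !in_robust_loss_region.
Qed.
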